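(* There exists a stochastic block model $\mathrm{SBM}(n;p,Q)$ (with the number of communities, $p$ and $Q$ allowed to depend on $n$) which can be distinguished from $\mathbb{G}(n,1/2)$ with high probability via the signed triangle count, but not via the signed count of any other connected graph on a constant number of vertices (with at least one edge).
   Context: Graphs are finite, simple and undirected. $\mathbb{G}(n,1/2)$ is the Erdős–Rényi random graph. A stochastic block model on $k$ communities is given by a probability vector $p\in(0,1]^k$ and a symmetric matrix $Q\in[-1,1]^{k\times k}$. A sample $\mathbf{G}\sim\mathrm{SBM}(n;p,Q)$ is an $n$-vertex graph produced by drawing i.i.d. labels $\mathbf{x}_1,\dots,\mathbf{x}_n\in[k]$ with pmf $p$, and then including each edge $(i,j)$ independently with probability $(1+Q_{\mathbf{x}_i,\mathbf{x}_j})/2$. The signed count of $H$ in an $n$-vertex graph $G$ with edge indicators $G_{ij}$ is $\mathrm{SC}_H(G)=\sum_{H_1\sim H}\prod_{(i,j)\in E(H_1)}(2G_{ij}-1)$, the sum over all subgraphs $H_1$ of $K_n$ isomorphic to $H$. With $f=\mathrm{SC}_H$ and $M_n=\max(\mathrm{Var}_{\mathbb{G}(n,1/2)}[f]^{1/2},\mathrm{Var}_{\mathbb{P}_n}[f]^{1/2})$, the signed count of $H$ distinguishes $\mathbb{P}_n$ from $\mathbb{G}(n,1/2)$ (with high probability) if $|\mathbb{E}_{\mathbb{P}_n}f-\mathbb{E}_{\mathbb{G}(n,1/2)}f|=\omega(M_n)$, and it fails to distinguish (''not via'') if $|\mathbb{E}_{\mathbb{P}_n}f-\mathbb{E}_{\mathbb{G}(n,1/2)}f|=o(M_n)$,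 as $n\to\infty$. *)

(* Defs.v *)
From HB Require Import structures.
From mathcomp Require Import all_boot all_order all_algebra.
From mathcomp Require Import all_classical all_reals all_analysis.

Set Implicit Arguments.
Unset Strict Implicit.
Unset Printing Implicit Defensive.

Import Order.TTheory GRing.Theory Num.Theory.
Import numFieldNormedType.Exports.

Local Open Scope ring_scope.

(** * Finite simple graphs *)

Definition is_sgraph (T : finType) (E : {set T * T}) : bool :=
  [forall x, (x, x) \notin E] &&
  [forall x, forall y, ((x, y) \in E) == ((y, x) \in E)].

Record sgraph (T : finType) := SGraph {
  edges : {set T * T};
  _ : is_sgraph edges }.

HB.instance Definition _ (T : finType) := [isSub for @edges T].
HB.instance Definition _ (T : finType) := [Finite of sgraph T by <:].

Definition adj (T : finType) (G : sgraph T) : rel T :=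
  fun x y => (x, y) \in edges G.

Lemma is_sgraph_complete (T : finType) :
  is_sgraph [set e : T * T | e.1 != e.2].
Proof.
apply/andP; split; apply/forallP => x; first by rewrite inE /= eqxx.
by apply/forallP => y; rewrite !inE /= (eq_sym x).
Qed.

Definition complete (T : finType) : sgraph T := SGraph (is_sgraph_complete T).

Definition triangle : sgraph 'I_3 := complete 'I_3.

Definition isomorphic (T U : finType) (G : sgraph T) (H : sgraph U) : Prop :=
  exists2 f : T -> U, bijective f & {mono f : x y / adj G x y >-> adj H x y}.

Definition connected_graph (T : finType) (G : sgraph T) : Prop :=
  (0 < #|T|)%N /\ forall x y : T, connect (adj G) x y.

Definition has_edge (T : finType) (G : sgraph T) : Prop :=
  exists x y : T, adj G x y.

(** * Signed subgraph counts *)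

(* A subgraph of the complete graph on [U] is a pair [(V, E)] of a vertex set
   and a graph on [U] all of whose edges lie within [V].  Such a pair is
   isomorphic to [H] iff it is the image of [H] under an injection [T -> U]. *)
Definition is_copy (T U : finType) (H : sgraph T)
    (H1 : {set U} * sgraph U) : bool :=
  [exists f : {ffun T -> U},
    [&& injectiveb f,
        H1.1 == [set f u | u : T] &
        edges H1.2 == [set (f e.1, f e.2) | e in edges H]]].

(* Unordered pairs {i, j} are represented by the ordered pairs with i < j. *)
Definition signed_count (R : realType) (T : finType) (H : sgraph T) (n : nat)
    (G : sgraph 'I_n) : R :=
  \sum_(H1 : {set 'I_n} * sgraph 'I_n | is_copy H H1)
    \prod_(e : 'I_n * 'I_n | (e.1 < e.2)%N && adj H1.2 e.1 e.2)
      (2 * (adj G e.1 e.2)%:R - 1).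

(** * Random graphs *)

Definition graph_mean (R : realType) (n : nat) (P f : sgraph 'I_n -> R) : R :=
  \sum_(G : sgraph 'I_n) P G * f G.

Definition graph_var (R : realType) (n : nat) (P f : sgraph 'I_n -> R) : R :=
  graph_mean P (fun G => (f G - graph_mean P f) ^+ 2).

Definition ER_half (R : realType) (n : nat) (G : sgraph 'I_n) : R :=
  \prod_(e : 'I_n * 'I_n | (e.1 < e.2)%N)
    bernoulli_pmf (1 / 2 : R) (adj G e.1 e.2).

Record sbm (R : realType) := SBM {
  ncomm : nat;
  label_prob : 'I_ncomm -> R;
  bias : 'M[R]_ncomm;
  label_prob_itv : forall a, 0 < label_prob a <= 1;
  label_prob_sum : \sum_(a < ncomm) label_prob a = 1;
  bias_sym : bias^T = bias;
  bias_itv : forall a b, -1 <= bias a b <= 1 }.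

(* The marginal law of the graph: the labels [x] are averaged out. *)
Definition SBM_pmf (R : realType) (S : sbm R) (n : nat) (G : sgraph 'I_n) : R :=
  \sum_(x : {ffun 'I_n -> 'I_(ncomm S)})
    (\prod_(i < n) label_prob (x i)) *
    \prod_(e : 'I_n * 'I_n | (e.1 < e.2)%N)
      bernoulli_pmf ((1 + bias S (x e.1) (x e.2)) / 2) (adj G e.1 e.2).

(** * Distinguishing by a signed count *)

Local Open Scope classical_set_scope.

(* The [n]-th model of the sequence [S] is used on [n] vertices. *)
Definition mean_gap (R : realType) (S : nat -> sbm R) (T : finType)
    (H : sgraph T) (n : nat) : R :=
  `| graph_mean (@SBM_pmf R (S n) n) (@signed_count R T H n)
     - graph_mean (@ER_half R n) (@signed_count R T H n) |.

Definition max_std (R : realType) (S : nat -> sbm R) (T : finType)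
    (H : sgraph T) (n : nat) : R :=
  Num.max (Num.sqrt (graph_var (@ER_half R n) (@signed_count R T H n)))
          (Num.sqrt (graph_var (@SBM_pmf R (S n) n) (@signed_count R T H n))).

(* [mean_gap = omega(max_std)] is written as [max_std = o(mean_gap)]. *)
Definition distinguishes (R : realType) (S : nat -> sbm R) (T : finType)
    (H : sgraph T) : Prop :=
  max_std S H =o_\oo mean_gap S H.

Definition fails_to_distinguish (R : realType) (S : nat -> sbm R) (T : finType)
    (H : sgraph T) : Prop :=
  mean_gap S H =o_\oo max_std S H.

(* Main.v *)
Require Import Defs.
From mathcomp Require Import all_boot all_order all_algebra.
From mathcomp Require Import all_classical all_reals all_analysis.
From mathcomp Require Import zify ring lra.

Set Implicit Arguments.
Unset Strict Implicit.
Unset Printing Implicit Defensive.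

Import Order.TTheory GRing.Theory Num.Theory.
Import numFieldNormedType.Exports.

Local Open Scope ring_scope.

(** A label is one of [D] groups together with a sign, all [2 D] labels being
    equally likely; the bias of two labels is the product of their signs if
    their groups agree and 0 otherwise.  Averaging over the signs kills every
    graph with a vertex of odd degree, and a connected graph on [v] vertices
    with all degrees even has signed density [D^(1 - v)], the probability that
    its vertices fall into one group.  Apart from the triangle, a connected
    graph with an edge and all degrees even has [v >= 4] vertices.  Its mean
    count [N D^(1 - v)], for [N <= n^v] copies, is negligible against the
    Erdos-Renyi deviation, which is at least [sqrt N], as soon as
    [n^2 = o(D^3)].  For the triangle, pairs sharing at most one vertex have
    nonpositive covariance and pairs sharing an edge have covariance at most
    [D^(-3)], so the variance is [O(n^3 + n^4 D^(-3))], against a squared mean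
    of order [n^6 D^(-4)]: the triangle distinguishes if moreover
    [D^4 = o(n^3)].  Take [D] close to [n^(7/10)]. *)

(** * Means of edge characters *)

Lemma adj_irr (T : finType) (G : sgraph T) x : adj G x x = false.
Proof. by have /andP[/forallP/(_ x)/negbTE] := valP G. Qed.

Lemma adj_sym (T : finType) (G : sgraph T) x y : adj G x y = adj G y x.
Proof. by have /andP[_ /forallP/(_ x)/forallP/(_ y)/eqP] := valP G. Qed.

Lemma sgraph_inj (T : finType) (G G' : sgraph T) : adj G =2 adj G' -> G = G'.
Proof. by move=> eqG; apply/val_inj/setP => -[x y]; exact: eqG. Qed.

Section EdgeCharacters.
Variables (R : realType) (n : nat).
Implicit Types (G : sgraph 'I_n) (D : {set 'I_n * 'I_n}) (q : 'I_n * 'I_n -> R).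

Definition symmetric_hull (f : {ffun 'I_n * 'I_n -> bool}) :=
  [set e : 'I_n * 'I_n |
    (e.1 < e.2)%N && f e || (e.2 < e.1)%N && f (e.2, e.1)].

Lemma symmetric_hull_sgraph f : is_sgraph (symmetric_hull f).
Proof.
apply/andP; split; apply/forallP => x; first by rewrite inE /= ltnn.
by apply/forallP => y; rewrite !inE /= orbC.
Qed.

(** A graph is a free choice of one boolean per increasing pair, so the sum over graphs factors by
    distributivity. *)
Lemma sum_sgraph (F : 'I_n * 'I_n -> bool -> R) :
  \sum_(G : sgraph 'I_n) \prod_(e : 'I_n * 'I_n | (e.1 < e.2)%N)
     F e (adj G e.1 e.2) =
  \prod_(e : 'I_n * 'I_n | (e.1 < e.2)%N) (F e true + F e false).
Proof.
transitivity (\prod_(e : 'I_n * 'I_n | (e.1 < e.2)%N) \sum_(b : bool) F e b).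
  rewrite (big_distr_big_dep false (fun e : 'I_n * 'I_n => (e.1 < e.2)%N)).
  pose graph_of f := SGraph (symmetric_hull_sgraph f).
  (* The families given by the distributive law are [false] off the increasing pairs, so the
     indicator of a graph must be cut down to these pairs. *)
  pose ind G := [ffun e : 'I_n * 'I_n => (e.1 < e.2)%N && adj G e.1 e.2].
  rewrite (reindex_onto ind graph_of) /=; last first.
    move=> f /pfamilyP[/fintype.subsetP supp _]; apply/ffunP => -[u v]; rewrite ffunE /=.
    have [lt_uv|le_vu] := boolP (u < v)%N.
      by rewrite /adj inE /= lt_uv ltnNge (ltnW lt_uv) /= orbF.
    apply/esym/idP => fuv; have: (u, v) \in false.-support f by rewrite inE fuv.
    by move/supp; rewrite /in_mem /= (negbTE le_vu).
  apply: eq_big => [G|G _].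
    apply/esym/andP; split; last first.
      apply/eqP/sgraph_inj => u v; rewrite /adj inE /= !ffunE /=.
      have [_|_|/ord_inj ->] /= := ltngtP u v; first by rewrite orbF.
        by rewrite adj_sym.
      by rewrite -[RHS]/(adj G v v) adj_irr.
    apply/pfamilyP; split => //; apply/fintype.subsetP => e.
    by rewrite inE ffunE [in X in _ -> X]/in_mem /=; case: (_ < _)%N.
  by apply: eq_bigr => e lt_e; rewrite ffunE lt_e.
by apply: eq_bigr => e _; rewrite big_bool.
Qed.

(** The Fourier character of the edge cube indexed by [D]. Any set of pairs is allowed, so that
    symmetric differences need not be repackaged as graphs. *)
Definition edge_char D G : R :=
  \prod_(e : 'I_n * 'I_n | (e.1 < e.2)%N && (e \in D))
    (2 * (adj G e.1 e.2)%:R - 1).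

Lemma signed_countE (T : finType) (H : sgraph T) G :
  signed_count R H G =
  \sum_(H1 : {set 'I_n} * sgraph 'I_n | is_copy H H1) edge_char (edges H1.2) G.
Proof.
by apply: eq_bigr => H1 _; apply: eq_bigl => -[u v].
Qed.

Definition symdiff D D' := (D :\: D') :|: (D' :\: D).

(** Each factor is a sign, so an edge common to both sets contributes a square equal to 1. *)
Lemma edge_charM D D' G :
  edge_char D G * edge_char D' G = edge_char (symdiff D D') G.
Proof.
rewrite /edge_char !big_mkcondr -big_split; apply: eq_bigr => e _.
rewrite !inE; case: (_ \in D); case: (_ \in D') => /=;
  rewrite ?mulr1 ?mul1r //.
by case: (adj _ _ _) => /=; ring.
Qed.

Definition graph_law q G : R :=
  \prod_(e : 'I_n * 'I_n | (e.1 < e.2)%N)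
    bernoulli_pmf ((1 + q e) / 2) (adj G e.1 e.2).

(** Edges are independent, and the sign of an edge present with probability [(1 + q e) / 2] has mean
    [q e]. *)
Lemma graph_law_edge_char q D :
  \sum_G graph_law q G * edge_char D G =
  \prod_(e : 'I_n * 'I_n | (e.1 < e.2)%N && (e \in D)) q e.
Proof.
pose F (e : 'I_n * 'I_n) b : R := bernoulli_pmf ((1 + q e) / 2) b *
  (if e \in D then 2 * b%:R - 1 else 1).
transitivity (\sum_G \prod_(e : 'I_n * 'I_n | (e.1 < e.2)%N) F e (adj G e.1 e.2)).
  by apply: eq_bigr => G _; rewrite /edge_char big_mkcondr -big_split.
rewrite sum_sgraph [RHS]big_mkcondr; apply: eq_bigr => e _.
by rewrite /F /bernoulli_pmf /=; case: ifP => _; field.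
Qed.

Lemma ER_halfE G : ER_half R G = graph_law (fun=> 0) G.
Proof. by apply: eq_bigr => e _; rewrite addr0. Qed.

Lemma ER_mean_edge_char D :
  graph_mean (@ER_half R n) (edge_char D) =
  [forall e : 'I_n * 'I_n, (e.1 < e.2)%N ==> (e \notin D)]%:R.
Proof.
rewrite /graph_mean; under eq_bigr do rewrite ER_halfE.
rewrite graph_law_edge_char; case: forallP => [noD|].
  rewrite big_pred0 // => e; have := noD e.
  by case: (_ < _)%N => //= /negbTE.
move=> exD; have /existsP[e] : [exists e : 'I_n * 'I_n, (e.1 < e.2)%N && (e \in D)].
  rewrite -[X in is_true X]negbK negb_exists; apply/forallP => noD; apply: exD => e.
  by have := noD e; rewrite negb_and; case: (_ < _)%N.
by move=> De; rewrite (bigD1 e) //= mul0r.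
Qed.

Variable S : sbm R.

Definition label_mean (f : {ffun 'I_n -> 'I_(ncomm S)} -> R) : R :=
  \sum_(x : {ffun 'I_n -> 'I_(ncomm S)}) (\prod_(i < n) label_prob (x i)) * f x.

Lemma SBM_mean_edge_char D :
  graph_mean (@SBM_pmf R S n) (edge_char D) =
  label_mean (fun x => \prod_(e : 'I_n * 'I_n | (e.1 < e.2)%N && (e \in D))
                         bias S (x e.1) (x e.2)).
Proof.
rewrite /graph_mean /SBM_pmf; under eq_bigr do rewrite mulr_suml.
rewrite exchange_big; apply: eq_bigr => x _ /=.
under eq_bigr do rewrite -mulrA.
by rewrite -mulr_sumr -graph_law_edge_char.
Qed.

Lemma label_mean_prod (phi : 'I_n -> 'I_(ncomm S) -> R) :
  label_mean (fun x => \prod_i phi i (x i)) =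
  \prod_i \sum_a label_prob a * phi i a.
Proof.
by rewrite bigA_distr_bigA; apply: eq_bigr => x _; rewrite big_split.
Qed.

Lemma label_mean_sum (I : finType) (f : I -> {ffun 'I_n -> 'I_(ncomm S)} -> R) :
  label_mean (fun x => \sum_c f c x) = \sum_c label_mean (f c).
Proof.
rewrite /label_mean exchange_big; apply: eq_bigr => x _.
by rewrite mulr_sumr.
Qed.

Lemma label_weight_ge0 (x : {ffun 'I_n -> 'I_(ncomm S)}) :
  0 <= \prod_(i < n) label_prob (x i) :> R.
Proof.
by apply: prodr_ge0 => i _; have /andP[/ltW] := label_prob_itv (x i).
Qed.

Lemma ler_label_mean (f g : {ffun 'I_n -> 'I_(ncomm S)} -> R) :
  (forall x, f x <= g x) -> label_mean f <= label_mean g.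
Proof. by move=> fg; apply: ler_sum => x _; rewrite ler_wpM2l ?label_weight_ge0. Qed.

Lemma label_mean1 : label_mean (fun=> 1) = 1.
Proof.
transitivity (label_mean (fun x => \prod_(i < n) (fun _ _ => 1) i (x i))).
  by apply: eq_bigr => x _; rewrite [X in _ = _ * X]big1.
rewrite (label_mean_prod (fun _ _ => 1)) big1 // => i _.
by rewrite -[RHS](label_prob_sum S); apply: eq_bigr => a _; rewrite mulr1.
Qed.

End EdgeCharacters.

(** * Second moments of sums of edge characters *)

Section GraphMean.
Variables (R : realType) (n : nat) (P : sgraph 'I_n -> R).

Lemma eq_graph_mean f g : f =1 g -> graph_mean P f = graph_mean P g.
Proof. by move=> fg; apply: eq_bigr => G _; rewrite fg. Qed.

Lemma graph_mean_sum (I : finType) (p : pred I) (f : I -> sgraph 'I_n -> R) :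
  graph_mean P (fun G => \sum_(i | p i) f i G) =
  \sum_(i | p i) graph_mean P (f i).
Proof.
rewrite /graph_mean exchange_big; apply: eq_bigr => G _.
by rewrite mulr_sumr.
Qed.

Lemma graph_varE f : graph_mean P (fun=> 1) = 1 ->
  graph_var P f = graph_mean P (fun G => f G ^+ 2) - graph_mean P f ^+ 2.
Proof.
(* The square is expanded around an arbitrary constant [m]; the mean of [f] is substituted
   afterwards. *)
have shift m : graph_mean P (fun G => (f G - m) ^+ 2) =
    graph_mean P (fun G => f G ^+ 2) - 2 * m * graph_mean P f
    + m ^+ 2 * graph_mean P (fun=> 1).
  rewrite /graph_mean !mulr_sumr -sumrB -big_split; apply: eq_bigr => G _ /=.
  by ring.
by move=> P1; rewrite /graph_var shift P1; ring.
Qed.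

Lemma graph_mean_sqr_sum (I : finType) (p : pred I) (D : I -> {set 'I_n * 'I_n}) :
  graph_mean P (fun G => (\sum_(i | p i) edge_char R (D i) G) ^+ 2) =
  \sum_(i | p i) \sum_(j | p j)
     graph_mean P (edge_char R (symdiff (D i) (D j))).
Proof.
under [RHS]eq_bigr do rewrite -graph_mean_sum.
rewrite -graph_mean_sum; apply: eq_graph_mean => G.
rewrite expr2 big_distrlr; apply: eq_bigr => i _; apply: eq_bigr => j _.
exact: edge_charM.
Qed.

End GraphMean.

Section TotalMass.
Variables (R : realType) (n : nat).

Lemma edge_char0 G : edge_char R (n := n) finset.set0 G = 1.
Proof. by rewrite /edge_char big_pred0 // => e; rewrite inE andbF. Qed.

Lemma symdiffxx (D : {set 'I_n * 'I_n}) : symdiff D D = finset.set0.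
Proof. by rewrite /symdiff finset.setDv finset.setU0. Qed.

Lemma ER_mass : graph_mean (@ER_half R n) (fun=> 1) = 1.
Proof.
rewrite -(eq_graph_mean _ edge_char0) ER_mean_edge_char.
by case: forallP => // -[] e; rewrite inE implybT.
Qed.

Lemma SBM_mass (S : sbm R) : graph_mean (@SBM_pmf R S n) (fun=> 1) = 1.
Proof.
rewrite -(eq_graph_mean _ edge_char0) SBM_mean_edge_char -[RHS](label_mean1 n S).
apply: eq_bigr => x _; congr (_ * _).
by rewrite big_pred0 // => e; rewrite inE andbF.
Qed.

End TotalMass.

(** * The signed group model *)

(** The right side is a product over all ordered adjacent pairs. Increasing pairs supply the factors
    [h e.1], and the decreasing ones, once swapped, the factors [h e.2]. *)
Lemma prod_edges_degree (R : comNzRingType) (n : nat) (K : sgraph 'I_n)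
    (h : 'I_n -> R) :
  \prod_(e : 'I_n * 'I_n | (e.1 < e.2)%N && (e \in edges K)) (h e.1 * h e.2) =
  \prod_i h i ^+ #|[set j | adj K i j]|.
Proof.
under [RHS]eq_bigr do rewrite -prodr_const.
rewrite pair_big_dep /=.
rewrite [RHS](eq_bigl (fun e => e \in edges K)); last by case=> u v; rewrite inE.
rewrite [RHS](bigID (fun e : 'I_n * 'I_n => (e.1 < e.2)%N)) /= big_split /=.
congr (_ * _); first by apply: eq_bigl => e; rewrite andbC.
have swap_inj : injective (fun e : 'I_n * 'I_n => (e.2, e.1)).
  by move=> [a b] [c e] [-> ->].
rewrite [RHS](reindex_inj swap_inj) /=.
apply: eq_bigl => -[u v] /=.
rewrite -[(v, u) \in _]/(adj K v u) -[(u, v) \in _]/(adj K u v) adj_sym.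
by case: ltngtP => [||/ord_inj->]; rewrite ?adj_irr ?andbT ?andbF.
Qed.

Section SignedGroups.
Variables (R : realType) (d : nat).

(** The labels of an [sbm] are ordinals, so a pair of group and sign is coded by its rank, which
    [grp] and [sgn] decode. Using [d.+1] keeps the number of groups positive. *)
Definition signed_group : finType := ('I_d.+1 * bool)%type.

Definition grp (a : 'I_#|signed_group|) : 'I_d.+1 := (enum_val a).1.
Definition sgn (a : 'I_#|signed_group|) : R := (-1) ^+ (enum_val a).2.

Definition signed_bias : 'M[R]_#|signed_group| :=
  \matrix_(a, b) if grp a == grp b then sgn a * sgn b else 0.

Lemma signed_group_gt0 : (0 < #|signed_group|)%N.
Proof. by rewrite card_prod card_ord card_bool muln2. Qed.

Lemma uniform_itv (a : 'I_#|signed_group|) : 0 < (#|signed_group|%:R^-1 : R) <= 1.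
Proof.
rewrite invr_gt0 ltr0n signed_group_gt0 invf_le1 ?ltr0n ?signed_group_gt0 //.
by rewrite ler1n signed_group_gt0.
Qed.

Lemma uniform_sum : \sum_(a < #|signed_group|) #|signed_group|%:R^-1 = 1 :> R.
Proof.
rewrite sumr_const card_ord -[LHS]mulr_natl divff //.
by rewrite pnatr_eq0 -lt0n signed_group_gt0.
Qed.

Lemma signed_bias_sym : signed_bias^T = signed_bias.
Proof. by apply/matrixP => a b; rewrite !mxE eq_sym mulrC. Qed.

Lemma normr_signed_bias a b : `|signed_bias a b| = (grp a == grp b)%:R.
Proof.
rewrite mxE; case: ifP => _; last by rewrite normr0.
by rewrite normrM /sgn !normrX normrN1 !expr1n mulr1.
Qed.

Lemma signed_bias_itv a b : -1 <= signed_bias a b <= 1.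
Proof. by rewrite -ler_norml normr_signed_bias lern1 leq_b1. Qed.

Definition signed_sbm : sbm R :=
  SBM uniform_itv uniform_sum signed_bias_sym signed_bias_itv.

Let delta : R := d.+1%:R^-1.

(** Group [c] has two labels, contributing 1 and [(-1) ^+ k]: they cancel for odd [k] and add up to
    the group's probability for even [k]. *)
Lemma group_sgn_mean (c : 'I_d.+1) (k : nat) :
  \sum_(a < #|signed_group|)
     #|signed_group|%:R^-1 * ((grp a == c)%:R * sgn a ^+ k) =
  (~~ odd k)%:R * delta.
Proof.
pose F (l : signed_group) : R :=
  #|signed_group|%:R^-1 * ((l.1 == c)%:R * ((-1) ^+ l.2) ^+ k).
transitivity (\sum_(l : signed_group) F l).
  by rewrite (reindex _ (onW_bij _ (@enum_val_bij signed_group))).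
have -> : \sum_(l : signed_group) F l =
    \sum_(g : 'I_d.+1) \sum_(b : bool) F (g, b).
  by rewrite pair_bigA; apply: eq_bigr => -[].
rewrite (bigD1 c) //= [X in _ + X]big1 => [|g /negbTE gc]; last first.
  by rewrite big_bool /F /= gc !mul0r !mulr0 addr0.
rewrite addr0 big_bool /F /= eqxx !mul1r expr0 expr1 expr1n -mulrDr addrC.
rewrite -signr_odd card_prod card_ord card_bool /delta.
by case: (odd k); rewrite /= natrM; field; rewrite addrC natr1 pnatr_eq0.
Qed.

Variable n : nat.
Implicit Types (x : {ffun 'I_n -> 'I_(ncomm signed_sbm)}) (V A B : {set 'I_n}).

Lemma prod_indicator V (p : pred 'I_n) :
  \prod_i (if i \in V then (p i)%:R else 1) = [forall i in V, p i]%:R :> R.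
Proof.
have [/forall_inP pV|] := boolP [forall i in V, p i].
  by apply: big1 => i _; case: ifP => // /pV ->.
rewrite negb_forall => /existsP[i]; rewrite negb_imply => /andP[Vi /negbTE npi].
by rewrite (bigD1 i) //= Vi npi mul0r.
Qed.

(** The target group may depend on the vertex, so that two disjoint sets can be sent to two
    different groups at once. *)
Definition hits V (t : 'I_n -> 'I_d.+1) x := [forall i in V, grp (x i) == t i].

Lemma label_mean_hits V t : label_mean (fun x => (hits V t x)%:R) = delta ^+ #|V|.
Proof.
pose phi i (a : 'I_(ncomm signed_sbm)) : R :=
  if i \in V then (grp a == t i)%:R else 1.
transitivity (label_mean (fun x => \prod_i phi i (x i))).
  by apply: eq_bigr => x _; rewrite -prod_indicator.
rewrite label_mean_prod.
rewrite -prodr_const [RHS]big_mkcond; apply: eq_bigr => i _; rewrite /phi.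
case: ifP => _; last first.
  by rewrite -[RHS](label_prob_sum signed_sbm); apply: eq_bigr => a _; rewrite mulr1.
rewrite -[RHS]mul1r -[1 * delta]/((~~ odd 0)%:R * delta) -(group_sgn_mean (t i)).
by apply: eq_bigr => a _; rewrite expr0 mulr1.
Qed.

Definition monochromatic V x :=
  [forall i in V, forall j in V, grp (x i) == grp (x j)].

(** A nonempty set lying in one group determines that group; the empty set would be counted once for
    every group. *)
Lemma monochromatic_sum V x : V != finset.set0 ->
  (monochromatic V x)%:R = \sum_c (hits V (fun=> c) x)%:R :> R.
Proof.
case/set0Pn => i0 Vi0.
have [/forall_inP mono|nmono] := boolP (monochromatic V x).
  rewrite (bigD1 (grp (x i0))) //= big1 ?addr0 => [|c /negbTE ci0].
    suff -> : hits V (fun=> grp (x i0)) x by [].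
    by apply/forall_inP => i Vi; have /forall_inP/(_ i0 Vi0) := mono i Vi.
  suff -> : hits V (fun=> c) x = false by [].
  by apply/negP => /forall_inP/(_ i0 Vi0); rewrite eq_sym ci0.
rewrite big1 // => c _; suff -> : hits V (fun=> c) x = false by [].
apply: contraNF nmono => /forall_inP hitc.
apply/forall_inP => i Vi; apply/forall_inP => j Vj.
by rewrite (eqP (hitc i Vi)) (eqP (hitc j Vj)).
Qed.

(** Connectedness of [K] on [V], phrased by test functions: what is constant along edges is constant
    on [V]. It is applied to the groups of the vertices. *)
Definition spans (K : sgraph 'I_n) V :=
  (forall i j, adj K i j -> i \in V) /\
  forall g : 'I_n -> 'I_d.+1, (forall i j, adj K i j -> g i = g j) ->
    {in V &, forall i j, g i = g j}.

(** If [V] is not in a single group, some edge joins two groups and its factor is 0. Otherwise every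
    factor is a product of signs, collected by degrees. *)
Lemma prod_signed_bias K V x : spans K V ->
  \prod_(e : 'I_n * 'I_n | (e.1 < e.2)%N && (e \in edges K))
     signed_bias (x e.1) (x e.2) =
  (monochromatic V x)%:R * \prod_i sgn (x i) ^+ #|[set j | adj K i j]|.
Proof.
move=> [KV spanV]; have [/forall_inP mono|nmono] := boolP (monochromatic V x).
  rewrite mul1r -(prod_edges_degree K (fun i => sgn (x i))).
  apply: eq_bigr => -[i j] /= /andP[_ Kij]; rewrite mxE.
  have Vi := KV _ _ Kij; have Vj : j \in V by apply: KV; rewrite adj_sym; exact: Kij.
  by have /forall_inP/(_ j Vj) -> := mono i Vi.
rewrite mul0r.
have [i [j [Kij gij]]] : exists i j, adj K i j /\ grp (x i) != grp (x j).
  apply: contrapT => noK; move/negP: nmono; apply.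
  have := spanV (fun i => grp (x i)) => /= {}spanV.
  apply/forall_inP => i Vi; apply/forall_inP => j Vj; apply/eqP/spanV => // u v Kuv.
  by apply: contrapT => /eqP guv; apply: noK; exists u, v.
(* The product runs over increasing pairs only, so the bad edge is oriented first. *)
wlog lt_ij : i j Kij gij / (i < j)%N.
  move=> W; have [||/ord_inj eq_ij] := ltngtP i j; first exact: W.
    by apply: W; rewrite 1?adj_sym 1?eq_sym.
  by rewrite eq_ij adj_irr in Kij.
rewrite (bigD1 (i, j)) /= ?lt_ij //.
by rewrite mxE (negbTE gij) mul0r.
Qed.

(** For each common group the labels separate: a vertex of [V] gives [delta] or 0 by the parity of
    its degree, and any other vertex gives 1. Summing over the [d.+1] groups cancels one factor
    [delta]. *)
Lemma signed_mean_edge_char K V : spans K V -> V != finset.set0 ->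
  graph_mean (@SBM_pmf R signed_sbm n) (edge_char R (edges K)) =
  [forall i in V, ~~ odd #|[set j | adj K i j]|]%:R * delta ^+ #|V|.-1.
Proof.
move=> spanK V0; rewrite SBM_mean_edge_char.
pose phi c i (a : 'I_(ncomm signed_sbm)) : R :=
  (if i \in V then (grp a == c)%:R else 1) * sgn a ^+ #|[set j | adj K i j]|.
transitivity (label_mean (fun x => \sum_c \prod_i phi c i (x i))).
  apply: eq_bigr => x _; congr (_ * _); rewrite (prod_signed_bias x spanK).
  rewrite monochromatic_sum // mulr_suml; apply: eq_bigr => c _.
  by rewrite /phi big_split /= prod_indicator.
rewrite label_mean_sum.
transitivity (\sum_(c < d.+1) [forall i in V, ~~ odd #|[set j | adj K i j]|]%:R
                * delta ^+ #|V|); last first.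
  rewrite sumr_const card_ord -mulrnAr; congr (_ * _).
  rewrite -[in LHS](prednK (_ : 0 < #|V|)%N); last by rewrite card_gt0.
  by rewrite exprS -mulrnAl -[delta *+ _]mulr_natl divff ?mul1r // pnatr_eq0.
apply: eq_bigr => c _; rewrite label_mean_prod -prod_indicator -prodr_const.
rewrite [X in _ * X]big_mkcond -big_split; apply: eq_bigr => i _ /=.
rewrite /phi; case: ifPn => Vi; first exact: group_sgn_mean.
rewrite mulr1 -[RHS](label_prob_sum signed_sbm); apply: eq_bigr => a _.
have -> : [set j | adj K i j] = finset.set0.
  by apply/setP => j; rewrite !inE; apply: contraNF Vi => /(proj1 spanK).
by rewrite cards0 expr0 !mulr1.
Qed.

(** A union bound over the groups taken: disjoint sets choose two groups freely, while a shared
    vertex forces a single one. The exponent is the number of vertices minus the number of free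
    choices. *)
Lemma label_mean_monochromatic2 A B : A != finset.set0 -> B != finset.set0 ->
  label_mean (fun x => (monochromatic A x && monochromatic B x)%:R) <=
  delta ^+ (#|A :|: B| - (1 + [disjoint A & B])).
Proof.
case/set0Pn => i0 Ai0 /set0Pn[j0 Bj0].
have dn0 : d.+1%:R != 0 :> R by rewrite pnatr_eq0.
have [disjAB|] := boolP [disjoint A & B].
  apply: (@le_trans _ _ (label_mean (fun x => \sum_(c : 'I_d.+1 * 'I_d.+1)
     (hits (A :|: B) (fun i => if i \in A then c.1 else c.2) x)%:R))).
    apply: ler_label_mean => x.
    case: andP => [[/forall_inP mA /forall_inP mB]|_]; last exact: sumr_ge0.
    rewrite (bigD1 (grp (x i0), grp (x j0))) //=.
    rewrite [hits _ _ _](_ : _ = true) ?lerDl ?sumr_ge0 //.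
    apply/forall_inP => i; rewrite inE; case: ifPn => /= [Ai _|_ Bi].
      by have /forall_inP/(_ i0 Ai0) := mA i Ai.
    by have /forall_inP/(_ j0 Bj0) := mB i Bi.
  rewrite label_mean_sum; under eq_bigr do rewrite label_mean_hits.
  rewrite sumr_const card_prod !card_ord.
  (* This keeps the natural subtraction in the exponent from truncating. *)
  have le2 : (2 <= #|A :|: B|)%N.
    have /eqP := cardsUI A B; rewrite (disjoint_setI0 disjAB) cards0 addn0 => /eqP ->.
    by apply: (@leq_add 1 1); rewrite card_gt0; apply/set0Pn; [exists i0 | exists j0].
  rewrite -[in leLHS](subnK le2) exprD -[leLHS]mulr_natr -mulrA natrM /delta.
  by rewrite (_ : _ ^+ 2 * _ = 1) ?mulr1 //; field.
rewrite -setI_eq0 => /set0Pn[k]; rewrite inE => /andP[Ak Bk]; rewrite addn0.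
apply: (@le_trans _ _ (label_mean (fun x => \sum_(c : 'I_d.+1)
   (hits (A :|: B) (fun=> c) x)%:R))).
  apply: ler_label_mean => x.
  case: andP => [[/forall_inP mA /forall_inP mB]|_]; last exact: sumr_ge0.
  rewrite (bigD1 (grp (x k))) //= [hits _ _ _](_ : _ = true) ?lerDl ?sumr_ge0 //.
  apply/forall_inP => i; rewrite inE => /orP[Ai|Bi].
    by have /forall_inP/(_ k Ak) := mA i Ai.
  by have /forall_inP/(_ k Bk) := mB i Bi.
rewrite label_mean_sum; under eq_bigr do rewrite label_mean_hits.
rewrite sumr_const card_ord.
have le1 : (1 <= #|A :|: B|)%N by rewrite card_gt0; apply/set0Pn; exists k; rewrite inE Ak.
rewrite -[in leLHS](subnK le1) exprD expr1 -[leLHS]mulr_natr -mulrA /delta.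
by rewrite mulVf ?mulr1.
Qed.

Lemma prod_signed_bias_le1 (D : {set 'I_n * 'I_n}) x :
  \prod_(e : 'I_n * 'I_n | (e.1 < e.2)%N && (e \in D))
     signed_bias (x e.1) (x e.2) <= 1.
Proof.
apply: le_trans (ler_norm _) _; rewrite normr_prod.
apply: (@le_trans _ _ (\prod_(e : 'I_n * 'I_n | (e.1 < e.2)%N && (e \in D)) 1)).
  apply: ler_prod => e _; rewrite normr_ge0 /= normr_signed_bias.
  by rewrite lern1 leq_b1.
by rewrite big1.
Qed.

End SignedGroups.

(** * Copies of a graph *)

Definition even_degrees (T : finType) (H : sgraph T) :=
  [forall x, ~~ odd #|[set y | adj H x y]|].

(** With at most three vertices, a positive even degree must be 2, so a non-isolated vertex is
    joined to both others. Starting from one edge, this makes the graph a triangle. *)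
Lemma even_degrees_card (T : finType) (H : sgraph T) :
  even_degrees H -> has_edge H -> ~ isomorphic H triangle -> (4 <= #|T|)%N.
Proof.
move=> /forallP evenH [x0 [y0 Hxy]] notK3; rewrite leqNgt; apply/negP => lt_T4.
have nbrE x : [set y | adj H x y] != finset.set0 ->
    [set y | adj H x y] = [set~ x] /\ #|T| = 3%N.
  move=> nbr0; have sub : [set y | adj H x y] \subset [set~ x].
    by apply/fintype.subsetP => y; rewrite !inE; apply: contraTneq => ->; rewrite adj_irr.
  have := subset_leq_card sub; rewrite cardsC1.
  have := evenH x; rewrite -card_gt0 in nbr0 *.
  case E : #|_| nbr0 => [|[|[|k]]] //= _ _ le_deg.
    split; last by move: lt_T4 le_deg; case: #|T| => [|[|[|[|]]]].
    apply/eqP; rewrite eqEcard sub cardsC1 E.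
    by move: lt_T4; case: #|T| => [|[|[|[|]]]].
  by move: lt_T4 le_deg; case: #|T| => [|[|[|[|]]]].
have nbr1 x y : adj H x y -> [set y | adj H x y] = [set~ x] /\ #|T| = 3%N.
  by move=> xy; apply: nbrE; apply/set0Pn; exists y; rewrite inE.
have [nbr_x0 cardT] := nbr1 _ _ Hxy.
have adjE x y : adj H x y = (x != y).
  have [z Hxz] : exists z, adj H x z.
    have [->|nx] := eqVneq x x0; first by exists y0.
    exists x0; rewrite adj_sym.
    have : x \in [set~ x0] by rewrite !inE.
    by rewrite -nbr_x0 inE.
  have [nbr_x _] := nbr1 _ _ Hxz.
  have : (y \in [set y | adj H x y]) = (y \in [set~ x]) by rewrite nbr_x.
  by rewrite !inE eq_sym.
apply: notK3; exists (fun x => cast_ord cardT (enum_rank x)).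
  exists (fun i => enum_val (cast_ord (esym cardT) i)) => x.
    by rewrite cast_ordK enum_rankK.
  by rewrite enum_valK cast_ordKV.
move=> x y; rewrite adjE /adj inE /=.
by rewrite (inj_eq (@cast_ord_inj _ _ _)) (inj_eq enum_rank_inj).
Qed.

Section Copies.
Variables (T : finType) (H : sgraph T) (n : nat).
Implicit Types (c : {set 'I_n} * sgraph 'I_n).

Lemma is_copyP c : is_copy H c -> exists f : T -> 'I_n,
  [/\ injective f, c.1 = [set f u | u : T],
      forall x y, adj c.2 (f x) (f y) = adj H x y &
      forall i j, adj c.2 i j -> exists x y, [/\ i = f x, j = f y & adj H x y]].
Proof.
case/existsP => f /and3P[/injectiveP f_inj /eqP defV /eqP defE].
have edgeP i j : adj c.2 i j -> exists x y, [/\ i = f x, j = f y & adj H x y].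
  by rewrite /adj defE => /imsetP[[x y] Hxy [-> ->]]; exists x, y.
exists f; split => // x y; apply/idP/idP.
  by case/edgeP => x' [y' [/f_inj -> /f_inj ->]].
by move=> Hxy; rewrite /adj defE; apply/imsetP; exists (x, y).
Qed.

Lemma card_copy c : is_copy H c -> #|c.1| = #|T|.
Proof. by case/is_copyP => f [f_inj -> _ _]; rewrite card_imset. Qed.

Lemma copy_ltn_edge c : has_edge H -> is_copy H c ->
  exists e : 'I_n * 'I_n, (e.1 < e.2)%N && (e \in edges c.2).
Proof.
move=> [x [y Hxy]] /is_copyP[f [_ _ adjf _]].
have Kxy : adj c.2 (f x) (f y) by rewrite adjf.
have [lt|lt|/ord_inj eq_f] := ltngtP (f x) (f y).
- by exists (f x, f y); rewrite lt.
- by exists (f y, f x); rewrite lt; move: Kxy; rewrite adj_sym.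
- by rewrite eq_f adj_irr in Kxy.
Qed.

Lemma copy_degree c (f : T -> 'I_n) x : injective f ->
  (forall x y, adj c.2 (f x) (f y) = adj H x y) ->
  (forall i j, adj c.2 i j -> exists x y, [/\ i = f x, j = f y & adj H x y]) ->
  #|[set j | adj c.2 (f x) j]| = #|[set y | adj H x y]|.
Proof.
move=> f_inj adjf edgef; rewrite -(card_imset _ f_inj); apply: eq_card => j.
apply/idP/imsetP => [|[y]]; last by rewrite !inE => Hxy ->; rewrite adjf.
by rewrite inE => /edgef[x' [y [/f_inj-> -> Hxy]]]; exists y; rewrite ?inE.
Qed.

Lemma copy_even_degrees c : is_copy H c ->
  [forall i in c.1, ~~ odd #|[set j | adj c.2 i j]|] = even_degrees H.
Proof.
case/is_copyP => f [f_inj defV adjf edgef].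
apply/forall_inP/forallP => [evenV x | evenH i].
  by rewrite -(copy_degree x f_inj adjf edgef) evenV // defV imset_f.
by rewrite defV => /imsetP[x _ ->]; rewrite (copy_degree x f_inj adjf edgef).
Qed.

(** A function constant along edges is constant along the image of a path of [H]. *)
Lemma copy_spans d c : connected_graph H -> is_copy H c -> spans d c.2 c.1.
Proof.
move=> [_ connH] /is_copyP[f [f_inj defV adjf edgef]]; split.
  by move=> i j /edgef[x [y [-> _ _]]]; rewrite defV imset_f.
move=> g gK i j; rewrite defV => /imsetP[x _ ->] /imsetP[y _ ->].
have /connectP[p] := connH x y; elim: p x => [|z p IHp] x /= => [_ -> //|].
by case/andP => Hxz /IHp{}IHp /IHp <-; apply: gK; rewrite adjf.
Qed.

Lemma copy_neq0 c : (0 < #|T|)%N -> is_copy H c -> c.1 != finset.set0.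
Proof. by move=> T0 /card_copy cT; rewrite -card_gt0 cT. Qed.

Lemma card_copies :
  (#|[pred c : {set 'I_n} * sgraph 'I_n | is_copy H c]| <= n ^ #|T|)%N.
Proof.
(* Non-injective maps may send an edge to a loop, so images are taken among plain pairs of sets,
   into which the copies embed by [forget]. *)
pose of_fun (f : {ffun T -> 'I_n}) :=
  ([set f u | u : T], [set (f e.1, f e.2) | e in edges H])
  : {set 'I_n} * {set 'I_n * 'I_n}.
pose forget (c : {set 'I_n} * sgraph 'I_n) :=
  (c.1, edges c.2) : {set 'I_n} * {set 'I_n * 'I_n}.
have forget_inj : injective forget by move=> [V K] [V' K'] [-> /val_inj ->].
rewrite -[X in (_ <= X ^ _)%N](card_ord n) -card_ffun -(card_imset _ forget_inj).
apply: leq_trans (leq_imset_card of_fun predT).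
apply: subset_leq_card; apply/fintype.subsetP => _ /imsetP[c + ->].
rewrite inE => /existsP[f /and3P[_ /eqP defV /eqP defE]].
by apply/imsetP; exists f; rewrite ?inE // /forget defV defE.
Qed.

Variable R : realType.

Lemma ER_mean_signed_count : has_edge H ->
  graph_mean (@ER_half R n) (@signed_count R T H n) = 0.
Proof.
move=> edgeH; rewrite (eq_graph_mean _ (signed_countE R H (n := n))) graph_mean_sum.
apply: big1 => c copyH1; rewrite ER_mean_edge_char.
case: forallP => // noE; have [e] := copy_ltn_edge edgeH copyH1.
by case/andP => lt_e De; have := noE e; rewrite lt_e De.
Qed.

(** The diagonal terms of the second moment give 1 per copy; the others are means of characters,
    hence 0 or 1. *)
Lemma ER_var_signed_count_ge : has_edge H ->
  #|[pred c : {set 'I_n} * sgraph 'I_n | is_copy H c]|%:R <=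
  graph_var (@ER_half R n) (@signed_count R T H n).
Proof.
move=> edgeH; rewrite graph_varE ?ER_mass // ER_mean_signed_count // expr0n subr0.
under eq_graph_mean do rewrite signed_countE.
rewrite graph_mean_sqr_sum -sumr_const.
apply: ler_sum => c copyH1; rewrite (bigD1 c) //=.
rewrite symdiffxx ER_mean_edge_char.
have -> : [forall e : 'I_n * 'I_n, (e.1 < e.2)%N ==> (e \notin finset.set0)].
  by apply/forallP => e; rewrite inE implybT.
by rewrite lerDl; apply: sumr_ge0 => c' _; rewrite ER_mean_edge_char ler0n.
Qed.

Lemma signed_mean_signed_count d : connected_graph H ->
  graph_mean (@SBM_pmf R (signed_sbm R d) n) (@signed_count R T H n) =
  #|[pred c : {set 'I_n} * sgraph 'I_n | is_copy H c]|%:R *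
  ((even_degrees H)%:R * d.+1%:R^-1 ^+ #|T|.-1).
Proof.
move=> connH; rewrite (eq_graph_mean _ (signed_countE R H (n := n))) graph_mean_sum.
rewrite mulr_natl -sumr_const; apply: eq_bigr => c copyH1.
rewrite (signed_mean_edge_char R (copy_spans d connH copyH1)).
  by rewrite copy_even_degrees ?card_copy.
by apply: copy_neq0 copyH1; case: connH.
Qed.

End Copies.

(** Squaring the hypothesis settles [v = 4]; each further vertex costs a factor [n] on the left
    against [D ^ 2] on the right. *)
Lemma leq_scale K n D v : (4 <= v)%N -> (0 < K)%N -> (K * n ^ 2 <= D ^ 3)%N ->
  (K ^ 2 * n ^ v <= D ^ (2 * v.-1))%N.
Proof.
move=> v4 K0 scale; have [D0|D0] := posnP D.
  move: scale; rewrite D0 exp0n // leqn0 muln_eq0 gtn_eqF //= expn_eq0 andbT.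
  by move=> /eqP ->; rewrite !exp0n ?muln0 //; lia.
(* Indeed [n ^ 2 <= K * n ^ 2 <= D ^ 3 <= D ^ 4]. *)
have le_n : (n <= D ^ 2)%N.
  rewrite -leq_sqr -expnM; apply: leq_trans (_ : D ^ 3 <= _)%N; last exact: leq_pexp2l.
  by apply: leq_trans scale; rewrite leq_pmull.
rewrite -(subnK v4) addn4 /=; set w := (v - 4)%N.
have -> : (K ^ 2 * n ^ w.+4 = (K * n ^ 2) ^ 2 * n ^ w)%N.
  by rewrite !expnS expn0; ring.
have -> : (D ^ (2 * w.+3) = (D ^ 3) ^ 2 * (D ^ 2) ^ w)%N.
  by rewrite -!expnM -expnD; congr (_ ^ _)%N; lia.
by rewrite leq_mul // ?leq_sqr //; case: w => // w; rewrite leq_exp2r.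
Qed.

(** * Triangles *)

Lemma symdiffC (n : nat) (D D' : {set 'I_n * 'I_n}) : symdiff D D' = symdiff D' D.
Proof. by rewrite /symdiff finset.setUC. Qed.

Lemma adj_triangle i j : adj triangle i j = (i != j).
Proof. by rewrite /adj inE. Qed.

Lemma connected_triangle : connected_graph triangle.
Proof.
split=> [|x y]; first by rewrite card_ord.
have [->|neq] := eqVneq x y; first exact: connect0.
by apply: connect1; rewrite adj_triangle.
Qed.

Lemma has_edge_triangle : has_edge triangle.
Proof. by exists ord0, ord_max; rewrite adj_triangle. Qed.

Lemma even_degrees_triangle : even_degrees triangle.
Proof.
apply/forallP => x; have -> : [set y | adj triangle x y] = [set~ x].
  by apply/setP => y; rewrite !inE adj_triangle eq_sym.
by rewrite cardsC1 card_ord.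
Qed.

Section Cliques.
Variable n : nat.
Implicit Types A B : {set 'I_n}.

Lemma is_sgraph_clique A :
  is_sgraph [set e : 'I_n * 'I_n | [&& e.1 \in A, e.2 \in A & e.1 != e.2]].
Proof.
apply/andP; split; apply/forallP => x; first by rewrite inE /= eqxx !andbF.
by apply/forallP => y; rewrite !inE /= andbCA (eq_sym x).
Qed.

Definition clique A := SGraph (is_sgraph_clique A).

Lemma adj_clique A i j : adj (clique A) i j = [&& i \in A, j \in A & i != j].
Proof. by rewrite /adj inE. Qed.

(** A copy of the triangle is determined by its vertex set, so copies are reindexed by 3-element
    sets. *)
Lemma triangle_copies (R : nmodType) (F : {set 'I_n} * sgraph 'I_n -> R) :
  \sum_(c | is_copy triangle c) F c = \sum_(A : {set 'I_n} | #|A| == 3) F (A, clique A).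
Proof.
rewrite (reindex_onto (fun A => (A, clique A)) (fun c => c.1)) /=.
  apply: eq_bigl => A; rewrite eqxx andbT; apply/idP/eqP => [/card_copy|cardA].
    by rewrite card_ord.
  pose f := [ffun i : 'I_3 => enum_val (cast_ord (esym cardA) i)].
  have f_inj : injective f.
    by move=> i j; rewrite !ffunE => /enum_val_inj/cast_ord_inj.
  have fA : A = [set f u | u : 'I_3].
    apply/eqP; rewrite eq_sym eqEcard card_imset // card_ord cardA leqnn andbT.
    by apply/fintype.subsetP => _ /imsetP[i _ ->]; rewrite ffunE enum_valP.
  apply/existsP; exists f; apply/and3P; split; [exact/injectiveP | exact/eqP |].
  apply/eqP/setP => -[i j]; rewrite inE /=.
  apply/and3P/imsetP => [[]|[[u v] + [-> ->]]].
    rewrite {1 2}fA => /imsetP[u _ ->] /imsetP[v _ ->] neq_f.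
    by exists (u, v) => //; rewrite inE /=; apply: contraNneq neq_f => ->.
  rewrite inE /= => neq_uv; rewrite (inj_eq f_inj) neq_uv.
  by rewrite {1 2}fA !imset_f.
move=> [V K] /= copyK; congr (_, _); apply: sgraph_inj => i j.
have [f [f_inj /= defV adjf edgef]] := is_copyP copyK.
rewrite adj_clique defV; apply/and3P/idP => [[/imsetP[u _ ->] /imsetP[v _ ->]]|Kij].
  by rewrite (inj_eq f_inj) adjf /adj inE.
have [u [v [-> -> Huv]]] := edgef _ _ Kij.
by rewrite !imset_f // (inj_eq f_inj); split=> //; move: Huv; rewrite /adj inE.
Qed.

Lemma card_triangle_copies :
  #|[pred c : {set 'I_n} * sgraph 'I_n | is_copy triangle c]| = 'C(n, 3).
Proof.
rewrite -sum1_card (triangle_copies (fun=> 1%N)) sum1_card -[in RHS](card_ord n).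
by rewrite -card_draws; apply: eq_card => A; rewrite !inE.
Qed.

(* A vertex [u] of [A] outside [B] is joined to all of [A] by edges that the
   clique on [B] does not cancel. *)
Lemma symdiff_clique_const (X : Type) (g : 'I_n -> X) A B u :
  u \in A -> u \notin B ->
  (forall e : 'I_n * 'I_n, (e.1 < e.2)%N ->
     e \in symdiff (edges (clique A)) (edges (clique B)) -> g e.1 = g e.2) ->
  {in A, forall i, g i = g u}.
Proof.
move=> Au Bu gE i Ai; have [lt|lt|/ord_inj -> //] := ltngtP i u.
  by apply: (gE (i, u)) => //; rewrite !inE /= Ai Au (negbTE Bu) neq_ltn lt !andbF.
by apply/esym/(gE (u, i)) => //; rewrite !inE /= Ai Au (negbTE Bu) neq_ltn lt.
Qed.

Lemma neq_card_setD A B : A != B -> #|A| = #|B| -> exists2 u, u \in A & u \notin B.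
Proof.
move=> neqAB cardAB; apply/fintype.subsetPn; apply: contraNN neqAB => subAB.
by rewrite eqEcard subAB cardAB /=.
Qed.

(** Such a set arises from [A] by trading one of its three vertices for one of the [n] available. *)
Lemma card_sharing_edge A : #|A| = 3%N ->
  (#|[set B : {set 'I_n} | (#|B| == 3) && (#|A :&: B| == 2)]| <= 3 * n)%N.
Proof.
move=> cardA; pose swap (p : 'I_n * 'I_n) := p.2 |: (A :\ p.1).
have -> : (3 * n = #|finset.setX A [set: 'I_n]|)%N by rewrite cardsX cardA cardsT card_ord.
apply: leq_trans (leq_imset_card swap _).
apply: subset_leq_card; apply/fintype.subsetP => B; rewrite inE => /andP[/eqP cardB /eqP cardI].
have /cards1P[a defa] : #|A :\: B| == 1%N by rewrite cardsD cardA cardI.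
have /cards1P[b defb] : #|B :\: A| == 1%N by rewrite cardsD cardB finset.setIC cardI.
have inDa i : (i \notin B) && (i \in A) = (i == a).
  by have /setP/(_ i) := defa; rewrite !inE.
have inDb i : (i \notin A) && (i \in B) = (i == b).
  by have /setP/(_ i) := defb; rewrite !inE.
have := inDa a; rewrite eqxx => /andP[_ Aa].
apply/imsetP; exists (a, b); first by rewrite !inE Aa.
apply/setP => i; rewrite !inE /= -inDa -inDb.
by case: (i \in A); case: (i \in B).
Qed.

Variables (R : realType) (d : nat).
Let delta : R := d.+1%:R^-1.
Let N : R := 'C(n, 3)%:R.

Lemma sum_triples (c : R) : \sum_(A : {set 'I_n} | #|A| == 3) c = N * c.
Proof.
rewrite sumr_const -[LHS]mulr_natl; congr (_%:R * _).
by rewrite -[in RHS](card_ord n) -card_draws; apply: eq_card => A; rewrite !inE.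
Qed.

(** Each triangle has a vertex outside the other, whose edges survive in the symmetric difference.
    So the product of biases vanishes unless both triangles are monochromatic. *)
Lemma signed_mean_symdiff A B : A != B -> #|A| = 3%N -> #|B| = 3%N ->
  graph_mean (@SBM_pmf R (signed_sbm R d) n)
    (edge_char R (symdiff (edges (clique A)) (edges (clique B)))) <=
  delta ^+ 4 + (#|A :&: B| == 2%N)%:R * delta ^+ 3.
Proof.
move=> neqAB cardA cardB.
have [u Au Bu] := neq_card_setD neqAB (etrans cardA (esym cardB)).
have [v Bv Av] : exists2 v, v \in B & v \notin A.
  by apply: neq_card_setD; rewrite 1?eq_sym // cardA cardB.
have A0 : A != finset.set0 by rewrite -card_gt0 cardA.
have B0 : B != finset.set0 by rewrite -card_gt0 cardB.
rewrite SBM_mean_edge_char; set D := symdiff _ _.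
apply: (@le_trans _ _ (label_mean (S := signed_sbm R d)
  (fun x => (monochromatic A x && monochromatic B x)%:R))).
  apply: ler_label_mean => x.
  have [|] := boolP [forall e : 'I_n * 'I_n,
    ((e.1 < e.2)%N && (e \in D)) ==> (grp (x e.1) == grp (x e.2))].
    move=> /forall_inP mono; suff -> : monochromatic A x && monochromatic B x.
      exact: prod_signed_bias_le1.
    have constA := symdiff_clique_const (g := fun i => grp (x i)) Au Bu.
    have constB := symdiff_clique_const (g := fun i => grp (x i)) Bv Av.
    have {}constA : {in A, forall i, grp (x i) = grp (x u)}.
      by apply: constA => e lt_e De; apply/eqP/mono; rewrite lt_e.
    have {}constB : {in B, forall i, grp (x i) = grp (x v)}.
      by apply: constB => e lt_e De; apply/eqP/mono; rewrite lt_e /D symdiffC.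
    apply/andP; split; apply/forall_inP => i Vi; apply/forall_inP => j Vj.
      by rewrite !constA.
    by rewrite !constB.
  rewrite negb_forall => /existsP[e]; rewrite negb_imply => /andP[De neq_e].
  by rewrite (bigD1 e) //= mxE (negbTE neq_e) mul0r ler0n.
apply: le_trans (label_mean_monochromatic2 R d A0 B0) _.
have cardU : #|A :|: B| = (6 - #|A :&: B|)%N by rewrite cardsU cardA cardB.
have ltI : (#|A :&: B| < 3)%N.
  rewrite -cardA proper_card // properE finset.subsetIl.
  by apply/fintype.subsetPn; exists u; rewrite // inE negb_and Bu orbT.
rewrite -setI_eq0 -cards_eq0 cardU.
(* For 0, 1 or 2 common vertices the exponent is [6 - 2], [5 - 1] or [4 - 1]. *)
by case: #|_| ltI => [|[|[|k]]] //= _; rewrite ?mul0r ?addr0 // mul1r lerDr exprn_ge0 // invr_ge0.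
Qed.

(** Summed over all pairs, the terms [delta ^+ 4] give exactly the squared mean. What remains is the
    diagonal and at most [3 * n] edge-sharing partners per triangle. *)
Lemma signed_var_triangle :
  graph_var (@SBM_pmf R (signed_sbm R d) n) (@signed_count R _ triangle n) <=
  N * (1 + 3 * n%:R * delta ^+ 3).
Proof.
rewrite graph_varE ?SBM_mass // signed_mean_signed_count; last exact: connected_triangle.
rewrite even_degrees_triangle card_triangle_copies.
rewrite -/N mul1r card_ord -/delta.
under eq_graph_mean do rewrite signed_countE triangle_copies.
rewrite graph_mean_sqr_sum lerBlDr.
have rowle (A : {set 'I_n}) : #|A| == 3 ->
    \sum_(B : {set 'I_n} | #|B| == 3) graph_mean (@SBM_pmf R (signed_sbm R d) n)
      (edge_char R (symdiff (edges (clique A)) (edges (clique B)))) <=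
    1 + 3 * n%:R * delta ^+ 3 + N * delta ^+ 4.
  move=> /eqP cardA; apply: (@le_trans _ _ (\sum_(B : {set 'I_n} | #|B| == 3)
     ((A == B)%:R + ((#|A :&: B| == 2%N)%:R * delta ^+ 3 + delta ^+ 4)))).
    apply: ler_sum => B /eqP cardB; have [<-|neqAB] := eqVneq A B.
      rewrite symdiffxx (eq_graph_mean _ (@edge_char0 R n)) SBM_mass lerDl.
      by rewrite addr_ge0 // ?mulr_ge0 // ?exprn_ge0 // invr_ge0.
    by rewrite add0r addrC signed_mean_symdiff.
  rewrite !big_split /= sum_triples -addrA.
  apply: lerD; last apply: lerD => //.
    rewrite (bigD1 A) ?cardA //= eqxx big1 ?addr0 // => B /andP[_].
    by rewrite eq_sym => /negbTE ->.
  rewrite -mulr_suml ler_wpM2r ?exprn_ge0 ?invr_ge0 // -natr_sum -natrM ler_nat.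
  apply: leq_trans (card_sharing_edge cardA); rewrite -sum1_card.
  rewrite [leqRHS](eq_bigl (fun B : {set 'I_n} => (#|B| == 3) && (#|A :&: B| == 2))).
    by rewrite [leqRHS]big_mkcondr; apply: eq_leq; apply: eq_bigr => B _; case: (_ == 2).
  by move=> B; rewrite inE.
apply: le_trans (ler_sum _ rowle) _; rewrite sum_triples.
by rewrite le_eqVlt; apply/orP; left; apply/eqP; ring.
Qed.

(** Characters of distinct triangles are orthogonal, so only the diagonal contributes. *)
Lemma ER_var_triangle :
  graph_var (@ER_half R n) (@signed_count R _ triangle n) <= N.
Proof.
rewrite graph_varE ?ER_mass // (ER_mean_signed_count _ _ has_edge_triangle) expr0n subr0.
under eq_graph_mean do rewrite signed_countE triangle_copies.
rewrite graph_mean_sqr_sum -[leRHS]mulr1 -sum_triples.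
apply: ler_sum => A /eqP cardA; rewrite (bigD1 A) ?cardA //= big1 ?addr0.
  by rewrite ER_mean_edge_char lern1 leq_b1.
move=> B /andP[/eqP cardB neqBA]; rewrite ER_mean_edge_char; case: forallP => // noE.
have [u Au Bu] : exists2 u, u \in A & u \notin B.
  by apply: neq_card_setD; rewrite 1?eq_sym // cardA cardB.
have idA : {in A, forall i, i = u}.
  (* Were the symmetric difference without edges, even the identity would be constant on [A]. *)
  apply: (symdiff_clique_const (g := id) Au Bu) => e lt_e De.
  by have := noE e; rewrite lt_e De.
suff : (#|A| <= 1)%N by rewrite cardA.
rewrite -(cards1 u); apply: subset_leq_card; apply/fintype.subsetP => i Ai.
by rewrite inE (idA i Ai).
Qed.

End Cliques.

(** * Choice of the number of groups *)

(* [(d n).+1] is the least positive integer that is at least [n^(7/10)]; any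
   exponent strictly between 2/3 and 3/4 would do. *)
Lemma group_scale : exists d : nat -> nat, forall K : nat, exists n0 : nat,
  forall n : nat, (n0 <= n)%N ->
    (K * n ^ 2 <= (d n).+1 ^ 3)%N /\ (K * (d n).+1 ^ 4 <= n ^ 3)%N.
Proof.
have exD n : exists m, (n ^ 7 <= m.+1 ^ 10)%N.
  exists n; apply: leq_trans (_ : n.+1 ^ 7 <= _)%N; last exact: leq_pexp2l.
  by rewrite leq_exp2r.
pose d n := ex_minn (exD n); exists d.
have d_ge n : (n ^ 7 <= (d n).+1 ^ 10)%N by rewrite /d; case: ex_minnP.
(* By minimality [d n] itself falls short of the threshold when positive, and
   [(d n).+1 <= 2 * d n]. *)
have [c d_le] : exists c, forall n, (0 < n)%N -> ((d n).+1 ^ 10 <= c * n ^ 7)%N.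
  exists (2 ^ 10)%N => n n0; rewrite /d; case: ex_minnP => -[|m] _ m_min.
    by rewrite exp1n muln_gt0 !expn_gt0 n0.
  have lt_m : (m.+1 ^ 10 < n ^ 7)%N.
    by rewrite ltnNge; apply/negP => /m_min; rewrite ltnn.
  apply: leq_trans (_ : (2 * m.+1) ^ 10 <= _)%N; first by rewrite leq_exp2r //; lia.
  by rewrite expnMn leq_pmul2l ?expn_gt0 // ltnW.
move=> K; exists (K ^ 10 * c ^ 4 + K ^ 10 + 1)%N => n le_n.
have n_gt0 : (0 < n)%N by lia.
(* After taking tenth powers, the first bound passes through [n ^ 21] and the second through
   [n ^ 29 <= n ^ 30]; one spare factor [n] absorbs the constants. *)
split; rewrite -(@leq_exp2r _ _ 10) // expnMn -!expnM.
  apply: leq_trans (_ : n * n ^ (2 * 10) <= _)%N.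
    have le_K : (K ^ 10 <= n)%N by lia.
    by rewrite leq_mul2r le_K orbT.
  have -> : ((d n).+1 ^ (3 * 10) = ((d n).+1 ^ 10) ^ 3)%N by rewrite -expnM.
  by apply: leq_trans (_ : (n ^ 7) ^ 3 <= _)%N; rewrite ?leq_exp2r // -expnM -expnS.
have -> : ((d n).+1 ^ (4 * 10) = ((d n).+1 ^ 10) ^ 4)%N by rewrite -expnM.
apply: leq_trans (_ : K ^ 10 * (c * n ^ 7) ^ 4 <= _)%N.
  by rewrite leq_mul2l leq_exp2r // d_le ?orbT.
rewrite expnMn mulnA -expnM.
apply: leq_trans (_ : n * n ^ (7 * 4) <= _)%N.
  have le_c : (K ^ 10 * c ^ 4 <= n)%N by lia.
  by rewrite leq_mul2r le_c orbT.
rewrite -expnS; exact: leq_pexp2l.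
Qed.

(** * Asymptotic comparison of mean gaps with standard deviations *)

Lemma leq_cube_bin3 n : (4 <= n)%N -> (n ^ 3 <= 24 * 'C(n, 3))%N.
Proof.
move=> n4; have := bin_ffact n 3; rewrite !ffactnS ffactn0 muln1 => bin3.
have -> : (24 * 'C(n, 3) = 4 * (n * (n.-1 * n.-2)))%N by rewrite -bin3 (_ : 3`! = 6)%N //; ring.
by case: n n4 {bin3} => [|[|[|[|n]]]] //= _; rewrite !expnS expn0; nia.
Qed.

(** A vertex of odd degree makes the gap 0. Otherwise the Erdos-Renyi deviation alone, at least the
    root of the number of copies, already dominates. *)
Lemma fails_signed (R : realType) (d : nat -> nat) (T : finType) (H : sgraph T) :
  (forall K : nat, exists n0 : nat, forall n : nat, (n0 <= n)%N ->
     (K * n ^ 2 <= (d n).+1 ^ 3)%N) ->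
  connected_graph H -> has_edge H -> ~ isomorphic H triangle ->
  fails_to_distinguish (fun n => signed_sbm R (d n)) H.
Proof.
move=> scale connH edgeH notK3; apply/eqoP => eps eps0.
pose K := (Num.truncn eps^-1).+1.
have K_eps : 1 <= eps * K%:R.
  by rewrite -ler_pdivrMl // mulr1 ltW // truncnS_gt.
have [n0 scaleK] := scale K.
exists n0 => // n /scaleK le_K.
rewrite /mean_gap /max_std /= signed_mean_signed_count // ER_mean_signed_count // subr0.
have [evenH|] := boolP (even_degrees H); last first.
  by rewrite mul0r mulr0 !normr0 mulr_ge0 // ltW.
rewrite mul1r normr_id.
set N := #|_|; set v := #|T|; set delta := _^-1.
have v4 : (4 <= v)%N by apply: even_degrees_card evenH edgeH notK3.
have delta0 : 0 <= delta by rewrite invr_ge0.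
rewrite ger0_norm; last by rewrite mulr_ge0 ?exprn_ge0.
apply: (@le_trans _ _ (eps * Num.sqrt N%:R)); last first.
  rewrite ler_wpM2l ?(ltW eps0) //; apply: le_trans (ler_norm _).
  by rewrite le_max ler_wsqrtr // ER_var_signed_count_ge.
(* One factor [Num.sqrt N%:R] is cancelled; squaring what remains leads to the form of
   [leq_scale]. *)
rewrite -[X in X * _ <= _](sqr_sqrtr (ler0n _ N)) expr2 -mulrA mulrC.
rewrite ler_wpM2r ?sqrtr_ge0 //.
rewrite -ler_sqr ?nnegrE ?mulr_ge0 ?sqrtr_ge0 ?exprn_ge0 ?(ltW eps0) //.
rewrite exprMn sqr_sqrtr // -exprM mulnC /delta exprVn.
rewrite ler_pdivrMr ?exprn_gt0 ?ltr0n //.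
apply: (@le_trans _ _ (n ^ v)%:R); first by rewrite ler_nat card_copies.
have := leq_scale v4 (ltn0Sn _ : (0 < K)%N) le_K.
rewrite -(ler_nat R) natrM !natrX => le_nv.
apply: le_trans (_ : eps ^+ 2 * (K%:R ^+ 2 * n%:R ^+ v) <= _); last first.
  by rewrite ler_wpM2l // exprn_ge0 // ltW.
rewrite mulrA -exprMn ler_peMl ?exprn_ge0 //.
by rewrite exprn_ege1.
Qed.

Lemma distinguishes_signed (R : realType) (d : nat -> nat) :
  (forall K : nat, exists n0 : nat, forall n : nat, (n0 <= n)%N ->
     (K * n ^ 2 <= (d n).+1 ^ 3)%N /\ (K * (d n).+1 ^ 4 <= n ^ 3)%N) ->
  distinguishes (fun n => signed_sbm R (d n)) triangle.
Proof.
move=> scale; apply/eqoP => eps eps0.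
(* Here 96 is 24 times 4: 24 from comparing [n ^ 3] with the binomial, 4 from bounding
   [D ^+ 4 + 3 * (n%:R * D)] by [4 * D ^+ 4]. *)
pose K := (Num.truncn (96 / eps ^+ 2)).+1.
have eps2 : 0 < eps ^+ 2 by rewrite exprn_gt0.
have K_eps : 96 <= eps ^+ 2 * K%:R.
  by rewrite -ler_pdivrMl // mulrC ltW // truncnS_gt.
have [n0 scaleK] := scale K.
exists (n0 + 4)%N => // n /= le_n; have [|le_2 le_4] := scaleK n; first lia.
rewrite /mean_gap /max_std /= (signed_mean_signed_count _ _ _ connected_triangle).
rewrite (ER_mean_signed_count _ _ has_edge_triangle) subr0.
rewrite even_degrees_triangle mul1r card_triangle_copies card_ord /= normr_id.
set N : R := 'C(n, 3)%:R; set delta := _^-1; set D : R := (d n).+1%:R.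
have D_gt0 : 0 < D by rewrite ltr0n.
have delta0 : 0 <= delta by rewrite invr_ge0.
have N_ge : 4 * D ^+ 4 <= eps ^+ 2 * N.
  have le_N : K%:R * D ^+ 4 <= 24 * N.
    rewrite /D /N -natrX -!natrM ler_nat.
    by apply: leq_trans le_4 (leq_cube_bin3 _); lia.
  have : 96 * D ^+ 4 <= eps ^+ 2 * (24 * N).
    apply: le_trans (_ : eps ^+ 2 * (K%:R * D ^+ 4) <= _).
      by rewrite [leRHS]mulrA ler_wpM2r // exprn_ge0 // ltW.
    by rewrite ler_wpM2l // ltW.
  by lra.
have nD : n%:R * D <= D ^+ 4.
  rewrite exprSr ler_wpM2r ?(ltW D_gt0) // /D -natrX ler_nat.
  by apply: leq_trans le_2; rewrite (leq_trans (_ : n <= n ^ 2)%N) ?leq_pmull //; nia.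
(* One bound serves both models, since the Erdos-Renyi variance is at most [N]. *)
have var_le V : V <= N * (1 + 3 * n%:R * delta ^+ 3) ->
    Num.sqrt V <= eps * (N * delta ^+ 2).
  move=> V_le; have gap0 : 0 <= eps * (N * delta ^+ 2).
    by rewrite !mulr_ge0 ?exprn_ge0 // ltW.
  rewrite -(ger0_norm gap0) -sqrtr_sqr ler_wsqrtr //; apply: le_trans V_le _.
  have -> : (eps * (N * delta ^+ 2)) ^+ 2 = N * (eps ^+ 2 * N * delta ^+ 4) by ring.
  rewrite ler_wpM2l // /delta !exprVn ler_pdivlMr ?exprn_gt0 //.
  have -> : (1 + 3 * n%:R / D ^+ 3) * D ^+ 4 = D ^+ 4 + 3 * (n%:R * D).
    by field; rewrite gt_eqF.
  by lra.
rewrite ger0_norm; last by rewrite le_max sqrtr_ge0.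
rewrite ger0_norm; last by rewrite mulr_ge0 ?exprn_ge0.
rewrite ge_max; apply/andP; split; apply: var_le; last exact: signed_var_triangle.
apply: le_trans (ER_var_triangle n R) _; rewrite ler_peMr // lerDl.
by rewrite !mulr_ge0 // exprn_ge0.
Qed.

Theorem theoremA7 (R : realType) :
  exists S : nat -> sbm R,
    distinguishes S triangle /\
    forall (T : finType) (H : sgraph T),
      connected_graph H -> has_edge H -> ~ isomorphic H triangle ->
      fails_to_distinguish S H.
Proof.
have [d scale] := group_scale.
exists (fun n => signed_sbm R (d n)); split; first exact: distinguishes_signed.
move=> T H connH edgeH notK3; apply: fails_signed => // K.
by have [n0 scaleK] := scale K; exists n0 => n /scaleK[].
Qed.
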